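(* Let $\leadsto$ be a relation on a type $A$ which is Noetherian and equipped with a local confluence structure, and let $\mathfrak L$ be the associated map from spans to confluence cycles. Let $Q:\text{(cycles of }\leadsto)\to\mathcal U$ be a type family which is stable under merging and under rotating. If $Q(\gamma)$ holds for every empty cycle $\gamma$ and $Q(\mathfrak L(\kappa))$ holds for every span $\kappa$, then $Q(\alpha)$ holds for every cycle $\alpha$. That is, we have a function $\big(\Pi(\gamma:\text{empty cycles}).Q(\gamma)\big)\to\big(\Pi(\kappa:\text{spans}).Q(\mathfrak L(\kappa))\big)\to\Pi(\alpha:\text{cycles}).Q(\alpha)$. If moreover $A$ is a set, then the first hypothesis can be replaced by $\Pi(a:A).\,Q(\epsilon_a)$, where $\epsilon_a$ is the trivial cycle $\mathsf{nil}$ based at $a$.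
   Context: Homotopy type theory setting; a relation on $A$ is an arbitrary type family $(\leadsto):A\to A\to\mathcal U$. Closures: $\leadsto^*$ is the inductive family with $\mathsf{nil}:a\leadsto^*a$ and $\mathsf{snoc}:(a\leadsto^*b)\to(b\leadsto c)\to(a\leadsto^*c)$; $(a\leadsto^s b):=(a\leadsto b)+(b\leadsto a)$; $\leadsto^{s*}:=(\leadsto^s)^*$. Elements of $a\leadsto^{s*}b$ are chains; they can be concatenated ($\alpha::\beta$) and inverted ($\alpha^{-1}$: reverse the order of segments and swap the summands). A cycle is an element of $\Sigma(a:A).(a\leadsto^{s*}a)$; it is empty if its length (number of segments) is $0$. Rotating a cycle $\mathsf{rot}$ moves its first segment to the end (so the base point moves to the next vertex). Accessibility: for a relation $<$, $\mathsf{acc}^<:A\to\mathcal U$ is inductively generated by $\mathsf{step}:\Pi(a:A).(\Pi(x:A).(x<a)\to\mathsf{acc}^<(x))\to\mathsf{acc}^<(a)$; $<$ is well-founded if $\Pi a.\mathsf{acc}^<(a)$. The relation $\leadsto$ is Noetherian if its opposite ($b\leadsto^{op}a:=a\leadsto b$) is well-founded. A span is a tuple $(u,v,w,s,t)$ with $s:u\leadsto v$, $t:u\leadsto w$; an extended cospan from $v$ to $w$ is $(x,\alpha,\beta)$ with $\alpha:v\leadsto^*x$, $\beta:w\leadsto^*x$. A local confluence structure is a function assigning to every span $(u,v,w,s,t)$ an extended cospan from $v$ to $w$. The confluence cycle $\mathfrak L(\kappa)$ of a span $\kappa$ is the cycle obtained by concatenating the span (as the chain $s^{-1}::t$ from $v$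 to $w$) with the reverse of the assigned extended cospan (the chain $\beta::\alpha^{-1}$ from $w$ back to $v$), with $\alpha,\beta$ regarded as chains. Merging: for $a,b:A$ and chains $\alpha,\beta,\gamma:a\leadsto^{s*}b$, the cycle $\alpha::\gamma^{-1}$ is the merge of $\alpha::\beta^{-1}$ and $\beta::\gamma^{-1}$. $Q$ is stable under merging if whenever $\gamma$ is the merge of $\alpha$ and $\beta$ and $Q(\alpha)$, $Q(\beta)$ hold, then $Q(\gamma)$ holds; $Q$ is stable under rotating if $Q(\delta)$ implies $Q(\mathsf{rot}(\delta))$. *)

(* Defs.v *)
Set Implicit Arguments.
Unset Strict Implicit.

(** Everything lives in [Type]: relations, accessibility and the families [Q]
    are proof-relevant, and no axiom (such as UIP) is assumed. *)

Definition relation (A : Type) := A -> A -> Type.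

Inductive acc (A : Type) (lt : relation A) : A -> Type :=
| step : forall a : A, (forall x : A, lt x a -> acc lt x) -> acc lt a.

Definition wellfounded (A : Type) (lt : relation A) : Type :=
  forall a : A, acc lt a.

Definition op (A : Type) (R : relation A) : relation A := fun b a => R a b.

Definition noetherian (A : Type) (R : relation A) : Type :=
  wellfounded (op R).

Inductive star (A : Type) (R : relation A) (a : A) : A -> Type :=
| snil : star R a a
| snoc : forall b c : A, star R a b -> R b c -> star R a c.

Arguments snil {A R} a.
Arguments snoc {A R a b c} _ _.

Definition symc (A : Type) (R : relation A) : relation A :=
  fun a b => (R a b + R b a)%type.

Definition chain (A : Type) (R : relation A) : relation A := star (symc R).

Fixpoint concat (A : Type) (R : relation A) (a b c : A)
    (p : star R a b) (q : star R b c) {struct q} : star R a c :=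
  match q in star _ _ c return star R a c with
  | snil _ => p
  | snoc q' r => snoc (concat p q') r
  end.

Definition single (A : Type) (R : relation A) (a b : A) (r : R a b) :
  star R a b := snoc (snil a) r.

Fixpoint slength (A : Type) (R : relation A) (a b : A) (p : star R a b) : nat :=
  match p with
  | snil _ => 0
  | snoc p' _ => S (slength p')
  end.

Definition swap (A : Type) (R : relation A) (a b : A) (r : symc R a b) :
    symc R b a :=
  match r with
  | inl s => inr s
  | inr s => inl s
  end.

Fixpoint inv (A : Type) (R : relation A) (a b : A) (p : chain R a b) :
    chain R b a :=
  match p in star _ _ b return chain R b a with
  | snil _ => snil a
  | snoc p' r => concat (single (swap r)) (inv p')
  end.

Fixpoint to_chain (A : Type) (R : relation A) (a b : A) (p : star R a b) :
    chain R a b :=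
  match p in star _ _ b return chain R a b with
  | snil _ => snil a
  | snoc p' r => snoc (to_chain p') (inl r)
  end.

Definition cycle (A : Type) (R : relation A) : Type := {a : A & chain R a a}.

Definition mk_cycle (A : Type) (R : relation A) (a : A) (p : chain R a a) :
  cycle R := existT (fun x => chain R x x) a p.

(** If [A] is not a set, an empty cycle based at [a] need not equal
    [mk_cycle (snil a)]: it amounts to an arbitrary loop [a = a]. *)
Definition is_empty (A : Type) (R : relation A) (g : cycle R) : Type :=
  slength (projT2 g) = 0.

Definition trivial_cycle (A : Type) (R : relation A) (a : A) : cycle R :=
  mk_cycle (snil a : chain R a a).

Fixpoint uncons (A : Type) (R : relation A) (a b : A) (p : star R a b) :
    (a = b) + {x : A & (R a x * star R x b)%type} :=
  match p in star _ _ b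
    return (a = b) + {x : A & (R a x * star R x b)%type} with
  | snil _ => inl eq_refl
  | @snoc _ _ _ b c p' r =>
      match uncons p' with
      | inl e =>
          inr (existT (fun x => (R a x * star R x c)%type) c
                 (eq_rect_r (fun y => R y c) r e, snil c))
      | inr (existT _ x (s, q)) =>
          inr (existT (fun x => (R a x * star R x c)%type) x (s, snoc q r))
      end
  end.

Definition rot (A : Type) (R : relation A) (g : cycle R) : cycle R :=
  match uncons (projT2 g) with
  | inl _ => g
  | inr (existT _ x (s, q)) => mk_cycle (snoc q s)
  end.

Record span (A : Type) (R : relation A) : Type := Span {
  apex : A;
  lft : A;
  rgt : A;
  leg_l : R apex lft;
  leg_r : R apex rgt
}.

Record ext_cospan (A : Type) (R : relation A) (v w : A) : Type := ExtCospan {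
  nadir : A;
  coleg_l : star R v nadir;
  coleg_r : star R w nadir
}.

Definition local_confluence (A : Type) (R : relation A) : Type :=
  forall k : span R, ext_cospan R (lft k) (rgt k).

Definition span_chain (A : Type) (R : relation A) (k : span R) :
    chain R (lft k) (rgt k) :=
  concat (inv (to_chain (single (leg_l k)))) (to_chain (single (leg_r k))).

Definition cospan_chain (A : Type) (R : relation A) (v w : A)
    (c : ext_cospan R v w) : chain R w v :=
  concat (to_chain (coleg_r c)) (inv (to_chain (coleg_l c))).

Definition confluence_cycle (A : Type) (R : relation A)
    (L : local_confluence R) (k : span R) : cycle R :=
  mk_cycle (concat (span_chain k) (cospan_chain (L k))).

Definition stable_under_merging (A : Type) (R : relation A)
    (Q : cycle R -> Type) : Type :=
  forall (a b : A) (p q r : chain R a b),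
    Q (mk_cycle (concat p (inv q))) ->
    Q (mk_cycle (concat q (inv r))) ->
    Q (mk_cycle (concat p (inv r))).

Definition stable_under_rotating (A : Type) (R : relation A)
    (Q : cycle R -> Type) : Type :=
  forall g : cycle R, Q g -> Q (rot g).

Definition is_set (A : Type) : Type :=
  forall (a b : A) (p q : a = b), p = q.

(* Main.v *)
(** Measure a cycle by the multiset of its vertices, ordered by the multiset
    extension of the transitive closure of [op R], which is well-founded.  A cycle
    without a peak [v <~ u ~> w] is empty, since otherwise some vertex would
    reach itself.  A cycle with a peak rotates to [span :: rest], which is the merge
    of the confluence cycle of the span and the cycle [cospan :: rest]; the
    latter is smaller, because [u] is replaced by vertices reachable from
    it.  Backtracking [s^-1 :: s] is a peak like any other. *)

From Stdlib Require Import PeanoNat List Permutation Relations Wellfounded.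
Require Import Defs.
Import ListNotations.

Set Implicit Arguments.
Unset Strict Implicit.

(** * The multiset order *)

(** Generating step of the multiset order, with lists up to permutation as multisets: one occurrence
    of [a] is traded for finitely many smaller elements, possibly none. *)
Definition multiset_step (A : Type) (lt : A -> A -> Prop) (N M : list A) : Prop :=
  exists a K X, Permutation M (a :: X) /\ Permutation N (K ++ X) /\
    Forall (fun k => lt k a) K.

Lemma Acc_multiset_perm (A : Type) (lt : A -> A -> Prop) (M N : list A) :
  Permutation M N -> Acc (multiset_step lt) M -> Acc (multiset_step lt) N.
Proof.
  intros e [H]; constructor; intros P (a & K & X & e1 & e2 & HK).
  apply H; exists a, K, X; repeat split; trivial.
  now transitivity N.
Qed.

(** Nested induction: outer on the accessibility of [a], inner on that of [M]. *)
Lemma Acc_multiset_cons (A : Type) (lt : A -> A -> Prop) (a : A) :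
  Acc lt a -> forall M, Acc (multiset_step lt) M -> Acc (multiset_step lt) (a :: M).
Proof.
  induction 1 as [a _ IHa]; induction 1 as [M accM IHM].
  constructor; intros N (c & K & X & e1 & e2 & HK).
  assert (Hc : In c (a :: M))
    by (apply (Permutation_in c (Permutation_sym e1)); now left).
  (* If [a] itself is replaced, the outer hypothesis adds the elements of [K] to [M] one at a time.
     If an element of [M] is replaced, [a] survives and the inner hypothesis applies. *)
  destruct Hc as [<- | Hc].
  - apply Acc_multiset_perm with (K ++ M).
    + apply Permutation_sym in e2; apply (Permutation_trans (l' := K ++ X)); trivial.
      now apply Permutation_app_head, (Permutation_cons_inv e1).
    + clear e2; induction HK as [|k K Hk HK IHK]; simpl.
      * now constructor.
      * now apply IHa.
  - destruct (in_split _ _ Hc) as (M1 & M2 & ->).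
    assert (eX : Permutation X (a :: M1 ++ M2)).
    { apply Permutation_cons_inv with c.
      rewrite <- e1; rewrite perm_swap; apply perm_skip.
      symmetry; apply Permutation_middle. }
    apply Acc_multiset_perm with (a :: K ++ M1 ++ M2).
    + rewrite e2, eX; apply Permutation_middle.
    + apply IHM; exists c, K, (M1 ++ M2); repeat split; trivial.
      symmetry; apply Permutation_middle.
Qed.

Lemma wf_multiset_step (A : Type) (lt : A -> A -> Prop) :
  well_founded lt -> well_founded (multiset_step lt).
Proof.
  intros wf M; induction M as [|a M IH].
  - constructor; intros N (c & K & X & e1 & _).
    now apply Permutation_nil_cons in e1.
  - now apply Acc_multiset_cons.
Qed.

(** * Chains *)

Lemma concat_assoc (A : Type) (R : relation A) (a b c d : A)
    (p : star R a b) (q : star R b c) (r : star R c d) :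
  concat (concat p q) r = concat p (concat q r).
Proof. induction r as [|d e r IH s]; simpl; congruence. Qed.

Lemma concat_snil_l (A : Type) (R : relation A) (a b : A) (p : star R a b) :
  concat (snil a) p = p.
Proof. induction p as [|b c p IH s]; simpl; congruence. Qed.

Lemma inv_concat (A : Type) (R : relation A) (a b c : A)
    (p : chain R a b) (q : chain R b c) :
  inv (concat p q) = concat (inv q) (inv p).
Proof.
  induction q as [|c d q IH s]; cbn [concat inv].
  - now rewrite concat_snil_l.
  - now rewrite IH, concat_assoc.
Qed.

Lemma inv_inv (A : Type) (R : relation A) (a b : A) (p : chain R a b) :
  inv (inv p) = p.
Proof.
  induction p as [|b c p IH s]; trivial.
  cbn [inv]; rewrite inv_concat, IH; now destruct s.
Qed.

Lemma to_chain_concat (A : Type) (R : relation A) (a b c : A)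
    (p : star R a b) (q : star R b c) :
  to_chain (concat p q) = concat (to_chain p) (to_chain q).
Proof. induction q as [|c d q IH s]; simpl; congruence. Qed.

(** Chains grow at the end; this view exposes the first segment, and being an indexed family it can
    be destructed without equations between endpoints. *)
Inductive cons_view (A : Type) (R : relation A) :
    forall a b : A, star R a b -> Type :=
| view_nil : forall a, cons_view (snil a)
| view_cons : forall a b c (s : R a b) (q : star R b c),
    cons_view (concat (single s) q).

Lemma cons_viewP (A : Type) (R : relation A) (a b : A) (p : star R a b) :
  cons_view p.
Proof.
  induction p as [|b c p IH s].
  - constructor.
  - destruct IH as [a|a b d t q].
    + exact (view_cons s (snil c)).
    + exact (view_cons t (snoc q s)).
Qed.

Lemma uncons_single_concat (A : Type) (R : relation A) (a b c : A)
    (s : R a b) (q : star R b c) :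
  uncons (concat (single s) q) =
    inr (existT (fun x => (R a x * star R x c)%type) b (s, q)).
Proof.
  induction q as [|c d q IH t]; trivial.
  cbn [concat uncons]; now rewrite IH.
Qed.

(** By induction on [p]: with the last segment [s] of [p] shifted to the front of [q], the induction
    hypothesis makes [s] the first segment of the cycle, and one [rot] sends it to the end. *)
Lemma stable_rotate (A : Type) (R : relation A) (Q : cycle R -> Type)
    (rotQ : stable_under_rotating Q) (a b : A)
    (p : chain R a b) (q : chain R b a) :
  Q (mk_cycle (concat p q)) -> Q (mk_cycle (concat q p)).
Proof.
  induction p as [|b c p IH s]; intros H.
  - now rewrite concat_snil_l in H.
  - change (snoc p s) with (concat p (single s)) in H.
    rewrite concat_assoc in H; apply IH in H; rewrite concat_assoc in H.
    apply rotQ in H; unfold rot, mk_cycle in H; cbn [projT2] in H.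
    now rewrite uncons_single_concat in H.
Qed.

Lemma slength_concat (A : Type) (R : relation A) (a b c : A)
    (p : star R a b) (q : star R b c) :
  slength (concat p q) = slength q + slength p.
Proof. induction q as [|c d q IH s]; simpl; congruence. Qed.

Lemma slength_inv (A : Type) (R : relation A) (a b : A) (p : chain R a b) :
  slength (inv p) = slength p.
Proof.
  induction p as [|b c p IH s]; trivial.
  cbn [inv]; rewrite slength_concat, IH, Nat.add_comm; reflexivity.
Qed.

Lemma slength_to_chain (A : Type) (R : relation A) (a b : A) (p : star R a b) :
  slength (to_chain p) = slength p.
Proof. induction p as [|b c p IH s]; simpl; congruence. Qed.

(** The transport along [e] has to stay: for a cycle, [e] is a loop that need not be [eq_refl]. *)
Lemma slength_eq0 (A : Type) (R : relation A) (a b : A) (p : star R a b) :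
  slength p = 0 -> {e : a = b | p = eq_rect a (star R a) (snil a) b e}.
Proof.
  destruct p as [|b c p s]; intros H.
  - now exists eq_refl.
  - discriminate H.
Qed.

(** * Vertices *)

(* The end point is not listed, so that each vertex of a cycle is counted once. *)
Fixpoint vertices (A : Type) (R : relation A) (a b : A) (p : star R a b) : list A :=
  match p with
  | snil _ => []
  | @snoc _ _ _ b _ p' _ => b :: vertices p'
  end.

Lemma vertices_concat (A : Type) (R : relation A) (a b c : A)
    (p : star R a b) (q : star R b c) :
  vertices (concat p q) = vertices q ++ vertices p.
Proof. induction q as [|c d q IH s]; simpl; congruence. Qed.

(** [inhabited] truncates the steps to [Prop], where the standard results on [clos_trans] and [Acc]
    apply. *)
Definition below (A : Type) (R : relation A) : A -> A -> Prop :=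
  clos_trans A (fun y x => inhabited (R x y)).

Lemma below_step (A : Type) (R : relation A) (a b : A) : R a b -> below R b a.
Proof. intros s; apply t_step; now constructor. Qed.

Lemma below_star (A : Type) (R : relation A) (u a b : A) :
  below R a u -> star R a b -> below R b u.
Proof.
  intros H p; induction p as [|b c p IH s]; trivial.
  apply t_trans with b; trivial; now apply below_step.
Qed.

Lemma wf_below (A : Type) (R : relation A) :
  noetherian R -> well_founded (below R).
Proof.
  intros noethR; apply wf_clos_trans; intros a.
  induction (noethR a) as [a _ IH]; constructor; intros b [s]; now apply IH.
Qed.

Lemma wf_irreflexive (A : Type) (lt : A -> A -> Prop) (a : A) :
  well_founded lt -> ~ lt a a.
Proof.
  intros wf; induction (wf a) as [a _ IH]; intros H; exact (IH a H H).
Qed.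

Lemma star_loop_nil (A : Type) (R : relation A) (noethR : noetherian R)
    (a : A) (p : star R a a) : slength p = 0.
Proof.
  (* The end point is freed so that induction on the chain is possible. *)
  assert (G : forall b (q : star R a b), slength q = 0 \/ below R b a).
  { intros b [|c d q s]; [now left|right].
    clear p; revert d s; induction q as [|e c q IH t]; intros d s.
    - now apply below_step.
    - apply t_trans with c; [now apply below_step|now apply IH]. }
  destruct (G a p) as [|H]; trivial.
  destruct (wf_irreflexive (wf_below noethR) H).
Qed.

Lemma vertices_to_chain_below (A : Type) (R : relation A) (u a b : A)
    (p : star R a b) :
  below R a u -> Forall (fun k => below R k u) (vertices (to_chain p)).
Proof.
  intros H; induction p as [|b c p IH s]; simpl; constructor; trivial.
  now apply below_star with a.
Qed.

Lemma vertices_inv_to_chain_below (A : Type) (R : relation A) (u a b : A)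
    (p : star R a b) :
  below R a u -> Forall (fun k => below R k u) (vertices (inv (to_chain p))).
Proof.
  intros H; induction p as [|b c p IH s]; cbn [to_chain inv]; [constructor|].
  rewrite vertices_concat; apply Forall_app; split; trivial.
  constructor; [|constructor].
  now apply below_star with a; [|exact (snoc p s)].
Qed.

(** Source of the decrease: both feet of the span are one step below the apex, and every vertex of
    the cospan is reachable from a foot. *)
Lemma vertices_inv_cospan_below (A : Type) (R : relation A) (k : span R)
    (c : ext_cospan R (lft k) (rgt k)) :
  Forall (fun x => below R x (apex k)) (vertices (inv (cospan_chain c))).
Proof.
  unfold cospan_chain; rewrite inv_concat, inv_inv, vertices_concat.
  apply Forall_app; split.
  - apply vertices_inv_to_chain_below, below_step, leg_r.
  - apply vertices_to_chain_below, below_step, leg_l.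
Qed.

(** * Peaks *)

Lemma peak_or_valley (A : Type) (R : relation A) (a b : A) (p : chain R a b) :
  {k : span R & {X : chain R a (lft k) & {Y : chain R (rgt k) b |
     p = concat X (concat (span_chain k) Y)}}} +
  {x : A & {f : star R a x & {g : star R b x |
     p = concat (to_chain f) (inv (to_chain g))}}}.
Proof.
  induction p as [|b c p IH [s|s]].
  - right; now exists a, (snil a), (snil a).
  - destruct IH as [(k & X & Y & ->)|(x & f & g & ->)].
    + left; now exists k, X, (snoc Y (inl s)).
    (* A forward segment extends [f] if [g] is empty; otherwise it forms a peak with the first
       segment of [g], with apex at the old end point. *)
    + destruct (cons_viewP g) as [x|b d x t g].
      * right; now exists c, (snoc f s), (snil c).
      * left; exists (Span t s).
        exists (concat (to_chain f) (inv (to_chain g))), (snil c).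
        rewrite to_chain_concat, inv_concat, <- concat_assoc; reflexivity.
  - destruct IH as [(k & X & Y & ->)|(x & f & g & ->)].
    + left; now exists k, X, (snoc Y (inr s)).
    + right; exists x, f, (concat (single s) g).
      rewrite to_chain_concat, inv_concat, <- concat_assoc; reflexivity.
Qed.

(** A closed valley with one empty side is a directed loop, hence empty; with both sides nonempty,
    their first segments form a peak across the base point. *)
Lemma empty_or_peak (A : Type) (R : relation A) (noethR : noetherian R)
    (a : A) (p : chain R a a) :
  (slength p = 0) +
  {k : span R & {Z : chain R (rgt k) (lft k) &
   {X : chain R a (lft k) & {Y : chain R (lft k) a |
      p = concat X Y /\ concat Y X = concat (span_chain k) Z}}}}.
Proof.
  destruct (peak_or_valley p) as [(k & X & Y & ->)|(x & f & g & ->)].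
  - right; exists k, (concat Y X), X, (concat (span_chain k) Y).
    split; trivial; apply concat_assoc.
  - destruct (cons_viewP f) as [a|a b x t f].
    + left; simpl; rewrite concat_snil_l.
      now rewrite slength_inv, slength_to_chain, star_loop_nil.
    + destruct (cons_viewP g) as [a|a c x s g].
      * left; exact (eq_trans (slength_to_chain _) (star_loop_nil noethR _)).
      * (* The peak sits at the base point. *)
        right; exists (Span s t), (concat (to_chain f) (inv (to_chain g))).
        exists (concat (to_chain (single t)) (concat (to_chain f) (inv (to_chain g)))).
        exists (inv (to_chain (single s))).
        rewrite !to_chain_concat, inv_concat, <- !concat_assoc.
        split; reflexivity.
Qed.

Lemma stable_all (A : Type) (R : relation A) (noethR : noetherian R)
    (L : local_confluence R) (Q : cycle R -> Type)
    (mergeQ : stable_under_merging Q) (rotQ : stable_under_rotating Q) :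
  (forall g : cycle R, is_empty g -> Q g) ->
  (forall k : span R, Q (confluence_cycle L k)) ->
  forall g : cycle R, Q g.
Proof.
  intros emptyQ spanQ.
  (* The slack [W] absorbs [lft k], which disappears from the cycle when the
     assigned cospan is empty. *)
  assert (G : forall M, Acc (multiset_step (below R)) M ->
    forall a (p : chain R a a) W, Permutation M (vertices p ++ W) -> Q (mk_cycle p)).
  { induction 1 as [M _ IH]; intros a p W e.
    destruct (empty_or_peak noethR p) as [H|(k & Z & X & Y & -> & eZ)];
      [now apply emptyQ|].
    (* Writing [Z] as a double inverse gives the cycle the shape of a merge, with [inv Z] as third
       chain. *)
    apply stable_rotate; trivial; rewrite eZ, <- (inv_inv Z).
    apply mergeQ with (inv (cospan_chain (L k))); rewrite inv_inv.
    - apply spanQ.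
    - set (C := inv (cospan_chain (L k))).
      apply (IH (vertices C ++ lft k :: vertices Z ++ W)) with (lft k :: W).
      + exists (apex k), (vertices C), (lft k :: vertices Z ++ W).
        split; [|split; [reflexivity|apply vertices_inv_cospan_below]].
        (* Rotation only permutes vertices, so they can be read off the span followed by [Z]; the
           span contributes [apex k] and [lft k]. *)
        rewrite e, vertices_concat, (Permutation_app_comm (vertices Y)).
        rewrite <- vertices_concat, eZ, vertices_concat; simpl.
        rewrite (Permutation_app_comm (vertices Z)); reflexivity.
      + rewrite vertices_concat, (Permutation_app_comm (vertices Z) (vertices C)).
        rewrite <- app_assoc; apply Permutation_app_head, Permutation_middle. }
  intros [a p].
  apply (G (vertices p) (wf_multiset_step (wf_below noethR) _) a p []).
  now rewrite app_nil_r.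
Qed.

Theorem theorem6p2 (A : Type) (R : relation A)
    (noethR : noetherian R) (L : local_confluence R)
    (Q : cycle R -> Type)
    (mergeQ : stable_under_merging Q) (rotQ : stable_under_rotating Q) :
  ((forall g : cycle R, is_empty g -> Q g) ->
   (forall k : span R, Q (confluence_cycle L k)) ->
   forall g : cycle R, Q g)
  *
  (is_set A ->
   (forall a : A, Q (trivial_cycle R a)) ->
   (forall k : span R, Q (confluence_cycle L k)) ->
   forall g : cycle R, Q g).
Proof.
  split; [now apply stable_all|].
  intros setA trivQ; apply stable_all; trivial.
  intros [a p] H; destruct (slength_eq0 H) as [e E]; simpl in E.
  rewrite E, (setA _ _ e eq_refl); apply trivQ.
Qed.
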